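(* Let $A\subseteq \mathbb{R}$ and $B=\mathbb{R}\setminus A$. Suppose that there exists an interval $I=(z-a,z+a)$, with $z\in\mathbb{R}$ and $a>0$, such that: - $B\cap I$ is dense in $I$; - $B\cap I$ is symmetric with respect to $z$; - $|B\cap I|>\aleph_0$. Then $C_p(H(A))$ contains a closed and discrete subspace of size $|B\cap I|$ and thus is not normal.
   Context: For $A\subseteq\mathbb{R}$, the Hattori space $H(A)$ is the set $\mathbb{R}$ with the topology $\tau(A)$ in which a point $x\in A$ has the local base $\{(x-\varepsilon,x+\varepsilon) : \varepsilon>0\}$ and a point $x\in\mathbb{R}\setminus A$ has the local base $\{[x,x+\varepsilon) : \varepsilon>0\}$. $C_p(X)$ is the space of continuous real-valued functions on $X$ with the topology of pointwise convergence. A set $E\subseteq\mathbb{R}$ is symmetric with respect to $z\in\mathbb{R}$ if $2z-x\in E$ for every $x\in E$. Density is in the Euclidean sense. *)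

(* Defs.v *)
From HB Require Import structures.
From mathcomp Require Import all_boot all_order all_algebra.
From mathcomp Require Import all_classical all_reals all_analysis.

Set Implicit Arguments.
Unset Strict Implicit.
Unset Printing Implicit Defensive.

Import Order.TTheory GRing.Theory Num.Theory.
Import numFieldNormedType.Exports.

Local Open Scope classical_set_scope.
Local Open Scope ring_scope.

Definition hattori_base {R : realType} (A : set R) (x e : R) : set R :=
  if x \in A then `]x - e, x + e[%classic else `[x, x + e[%classic.

Definition hattori {R : realType} (A : set R) : Type := R.

Section Hattori.
Context {R : realType} (A : set R).

HB.instance Definition _ := Choice.on (hattori A).

Definition hattori_nbhs (x : hattori A) : set_system (hattori A) :=
  filter_from [set e : R | 0 < e] (hattori_base A x).

HB.instance Definition _ := hasNbhs.Build (hattori A) hattori_nbhs.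

Lemma hattori_base_center (x e : R) : 0 < e -> hattori_base A x e x.
Proof.
move=> e0; rewrite /hattori_base; case: ifP => _ /=; rewrite in_itv /=.
  by rewrite ltrBlDr ltrDl e0.
by rewrite lexx ltrDl.
Qed.

Lemma hattori_base_le (x d e : R) :
  d <= e -> hattori_base A x d `<=` hattori_base A x e.
Proof.
move=> de y; rewrite /hattori_base.
case: ifP => _ /=; rewrite !in_itv /= => /andP[h1 h2]; apply/andP; split.
- by apply: le_lt_trans h1; rewrite lerB.
- by apply: lt_le_trans h2 _; rewrite lerD2l.
- by [].
- by apply: lt_le_trans h2 _; rewrite lerD2l.
Qed.

Lemma hattori_base_open (x e y : R) : hattori_base A x e y ->
  exists2 d, 0 < d & hattori_base A y d `<=` hattori_base A x e.
Proof.
rewrite {1}/hattori_base; case: ifPn => xA /=; rewrite in_itv /= => /andP[h1 h2].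
  exists (Num.min (y - (x - e)) (x + e - y)).
    by rewrite lt_min !subr_gt0 h1 h2.
  move=> t; rewrite /hattori_base xA.
  case: ifP => _ /=; rewrite !in_itv /= => /andP[t1 t2]; apply/andP; split.
  - apply: le_lt_trans t1; rewrite lerBrDr -lerBrDl.
    by rewrite ge_min lexx.
  - apply: lt_le_trans t2 _; rewrite -lerBrDl.
    by rewrite ge_min lexx orbT.
  - exact: lt_le_trans h1 t1.
  - apply: lt_le_trans t2 _; rewrite -lerBrDl.
    by rewrite ge_min lexx orbT.
move: h1; rewrite le_eqVlt => /orP[/eqP xy|xy].
  by subst y; exists e => //; rewrite -(ltrDl x).
exists (Num.min (y - x) (x + e - y)).
  by rewrite lt_min !subr_gt0 xy h2.
move=> t; rewrite /hattori_base (negbTE xA).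
case: ifP => _ /=; rewrite !in_itv /= => /andP[t1 t2]; apply/andP; split.
- apply: le_trans (ltW t1); rewrite lerBrDr -lerBrDl.
  by rewrite ge_min lexx.
- apply: lt_le_trans t2 _; rewrite -lerBrDl.
  by rewrite ge_min lexx orbT.
- exact: le_trans (ltW xy) t1.
- apply: lt_le_trans t2 _; rewrite -lerBrDl.
  by rewrite ge_min lexx orbT.
Qed.

Lemma hattori_nbhs_filter (x : hattori A) : ProperFilter (nbhs x).
Proof.
apply: filter_from_proper; last first.
  by move=> e /= e0; exists x; exact: hattori_base_center.
apply: filter_from_filter; first by exists 1 => /=.
move=> d e /= d0 e0; exists (Num.min d e); first by rewrite /= lt_min d0 e0.
by move=> t bt; split; apply: hattori_base_le bt; rewrite ge_min lexx ?orbT.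
Qed.

Lemma hattori_nbhs_singleton (x : hattori A) (U : set (hattori A)) :
  nbhs x U -> U x.
Proof. by move=> [e /= e0]; apply; exact: hattori_base_center. Qed.

Lemma hattori_nbhs_nbhs (x : hattori A) (U : set (hattori A)) :
  nbhs x U -> nbhs x (nbhs^~ U).
Proof.
move=> [e /= e0 eU]; exists e => // y /hattori_base_open[d d0 de].
by exists d => //; exact: subset_trans de eU.
Qed.

HB.instance Definition _ := Nbhs_isNbhsTopological.Build (hattori A)
  hattori_nbhs_filter hattori_nbhs_singleton hattori_nbhs_nbhs.

End Hattori.

(* A type alias: [continuousType X R] itself carries no canonical topology. *)
Definition Cp (R : realType) (X : topologicalType) : Type := continuousType X R.

HB.instance Definition _ (R : realType) (X : topologicalType) :=
  Choice.copy (Cp R X) (continuousType X R).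

HB.instance Definition _ (R : realType) (X : topologicalType) :=
  Topological.copy (Cp R X)
    (initial_topology
      (fun f : continuousType X R => (f : X -> R) : {ptws X -> R})).

Definition symmetric_wrt {R : realType} (z : R) (E : set R) : Prop :=
  forall x, E x -> E (2 * z - x).

(* Here [D] is coerced to a type, which carries the subspace topology. *)
Definition discrete_subspace {T : topologicalType} (D : set T) : Prop :=
  forall U : set D, open U.

(* Main.v *)
Require Import Defs.
From HB Require Import structures.
From mathcomp Require Import all_boot all_order all_algebra.
From mathcomp Require Import all_classical all_reals all_analysis.
From mathcomp Require Import lra.
Import Order.TTheory GRing.Theory Num.Theory.
Import numFieldNormedType.Exports.
Local Open Scope classical_set_scope.
Local Open Scope card_scope.
Local Open Scope ring_scope.

(* For x in B with mirror image 2z - x also in B, the function equal to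
   sgn (x - z) on [z - |x-z|, z + |x-z|) and to 0 elsewhere is continuous on
   H(A).  A pointwise limit of such functions is a function of the same shape,
   up to its values at the two end points, and right-continuity forces these
   values to be right; two values then identify the function.  Hence every
   subset of this family is closed, which makes the family closed and discrete.

   The family itself contradicts normality, without Jones' lemma (which would
   need more than uncountability).  Let E be the uncountable index set, Q a
   countable subset dense in E, and suppose that disjoint open sets U and V
   contain the functions indexed by E \ Q and by Q.  Only countably many
   coordinates are involved in chosen basic neighbourhoods, inside V, of the
   functions indexed by Q, so some x in E \ Q has neither x nor 2z - x among
   them.  A basic neighbourhood of the function of x inside U constrains
   finitely many coordinates; for q in Q close to x, the functions of q and x agree on
   those which the neighbourhood of q constrains as well, and a polynomial
   interpolating both lies in U and V. *)

(** * Evaluation and basic neighbourhoods in [Cp R X] *)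

Definition Cp_eval {R : realType} {X : topologicalType} (f : Cp R X) : X -> R :=
  (f : continuousType X R).

Lemma Cp_evalP {R : realType} {X : topologicalType} (f : X -> R) :
  continuous f -> exists g : Cp R X, Cp_eval g = f.
Proof.
move=> cf.
pose g : continuousType X R := HB.pack f (isContinuous.Build X R f cf).
by exists g.
Qed.

Lemma Cp_eval_cts {R : realType} {X : topologicalType} (f : Cp R X) :
  continuous (Cp_eval f).
Proof. exact: (@cts_fun _ _ (f : continuousType X R)). Qed.

Lemma Cp_eval_inj {R : realType} {X : topologicalType} :
  injective (@Cp_eval R X).
Proof.
move=> f g fg.
apply/(continuousEP (f : continuousType X R) g) => x.
by rewrite -[LHS]/(Cp_eval f x) fg.
Qed.

Lemma Cp_eval_continuous {R : realType} {X : topologicalType} (x : X) :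
  continuous (fun f : Cp R X => Cp_eval f x).
Proof.
move=> f.
apply: (@continuous_comp (Cp R X) {ptws X -> R} R (Cp_eval) (proj x)).
  exact: (@initial_continuous (continuousType X R) {ptws X -> R}
           (fun f : continuousType X R => (f : X -> R))).
exact: (@proj_continuous X (fun=> R)).
Qed.

Lemma Cp_nbhs_agree {R : realType} {X : topologicalType} (f : Cp R X)
    (U : set (Cp R X)) :
  nbhs f U -> exists s : seq X, forall g, {in s, Cp_eval g =1 Cp_eval f} -> U g.
Proof.
move=> [_ [[W oW <-] Wf] WU].
(* The filter generated by exact agreement with [f] on finite sets converges pointwise to [f], so
   the open set [W] belongs to it. *)
pose G := filter_from [set: seq X]
  (fun s => [set g : X -> R | {in s, g =1 Cp_eval f}]).
have FG : Filter G.
  apply: filter_from_filter; first by exists [::].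
  move=> s t _ _; exists (s ++ t) => // g gst.
  by split=> y ys; apply: gst; rewrite mem_cat ys ?orbT.
have : (G --> (Cp_eval f : {ptws X -> R})).
  apply/(@pointwise_cvgP X R) => t V /nbhs_singleton Vt.
  by exists [:: t] => // g /= gt; rewrite /= gt ?mem_head.
move=> /(_ W) []; first exact: open_nbhs_nbhs.
by move=> s _ sW; exists s => g gs; apply/WU/sW.
Qed.

(** * Interpolation and continuity on the Hattori space *)

Lemma exists_poly_interp {F : fieldType} (s : seq F) (v : F -> F) :
  exists p : {poly F}, {in s, forall x, p.[x] = v x}.
Proof.
elim: s => [|a s [p ps]]; first by exists 0.
have [as_|as_] := boolP (a \in s).
  by exists p => x; rewrite inE => /orP[/eqP->|]; exact: ps.
(* As in Newton interpolation, [q] vanishes on [s] but not at [a]: a multiple of it corrects the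
   value at [a] alone. *)
pose q : {poly F} := \prod_(b <- s) ('X - b%:P).
have qa : q.[a] != 0 by rewrite -/(root q a) root_prod_XsubC.
exists (p + ((v a - p.[a]) / q.[a]) *: q) => x; rewrite !hornerE.
have [->{x} _|xa] := eqVneq x a; first by rewrite divfK// addrC subrK.
rewrite inE (negPf xa)/= => xs.
have /rootP -> : root q x by rewrite root_prod_XsubC.
by rewrite mulr0 addr0 ps.
Qed.

Section HattoriCp.
Context {R : realType} {A : set R}.

Lemma hattori_base_right (x e w : R) :
  x <= w < x + e -> hattori_base A x e w.
Proof.
move=> /andP[xw we]; rewrite /hattori_base.
by case: ifP => _; rewrite /= in_itv/= ?xw we// andbT; lra.
Qed.

Lemma hattori_base_ball (x e w : R) :
  hattori_base A x e w -> `|x - w| < e.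
Proof.
rewrite /hattori_base ltr_distl.
by case: ifP => _; rewrite /= in_itv/= => /andP[? ?]; apply/andP; split; lra.
Qed.

Lemma continuous_hattori (f : R -> R) :
  continuous f -> continuous (f : hattori A -> R).
Proof.
move=> cf x U /(cf x) /nbhs_ballP[e e0 eU].
by exists e => // w /hattori_base_ball; exact: eU.
Qed.

Lemma Cp_hattori_interp (s : seq R) (v : R -> R) :
  exists f : Cp R (hattori A), {in s, Cp_eval f =1 v}.
Proof.
have [p ps] := exists_poly_interp s v.
have [f fp] := Cp_evalP _ (continuous_hattori _ (@continuous_horner R p)).
by exists f => x /ps; rewrite fp.
Qed.

Lemma Cp_hattori_right (f : Cp R (hattori A)) (x c : R) :
  Cp_eval f x != c ->
  exists2 e, 0 < e & forall w, x <= w < x + e -> Cp_eval f w != c.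
Proof.
move=> fxc.
have : nbhs (Cp_eval f x) [set y | y != c].
  exact: open_nbhs_nbhs.
move=> /(Cp_eval_cts f x)[e e0 ef]; exists e => // w xw.
exact/ef/hattori_base_right.
Qed.

(** The function is locally constant: [l] and [r] lie outside [A], so their basic neighbourhoods
    extend only to the right. *)
Lemma continuous_hattori_itv (l r c : R) : ~ A l -> ~ A r ->
  continuous ((fun y => if l <= y < r then c else 0) : hattori A -> R).
Proof.
move=> Al Ar y.
suff [e e0 ye] : exists2 e, 0 < e &
    forall w, hattori_base A y e w -> (l <= w < r) = (l <= y < r).
  move=> U /nbhs_singleton Uy; exists e => // w /ye /= ->.
  exact: Uy.
have [yl|ly] := ltP y l.
  exists (l - y); first by rewrite subr_gt0.
  move=> w /hattori_base_ball; rewrite ltr_distl => /andP[? ?].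
  by rewrite leNgt (_ : w < l)//; lra.
have [yr|ry] := ltP y r; last first.
  have [->|yr] := eqVneq y r.
    exists 1 => // w; rewrite /hattori_base memNset//= in_itv/= => /andP[rw _].
    by rewrite [w < r]ltNge rw andbF.
  have {}ry : r < y by rewrite lt_neqAle eq_sym yr.
  exists (y - r); first by rewrite subr_gt0.
  move=> w /hattori_base_ball; rewrite ltr_distl => /andP[? ?].
  by rewrite [w < r]ltNge (_ : r <= w) ?andbF//; lra.
have [<-|ly'] := eqVneq l y.
  exists (r - l); first by rewrite subr_gt0; lra.
  move=> w; rewrite /hattori_base memNset//= in_itv/= => /andP[-> ?].
  by lra.
have {}ly : l < y by rewrite lt_neqAle ly'.
exists (Num.min (y - l) (r - y)); first by rewrite lt_min !subr_gt0 ly.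
move=> w /hattori_base_ball; rewrite lt_min !ltr_distl.
move=> /andP[/andP[? ?] /andP[? ?]].
by apply/andP; split; lra.
Qed.

End HattoriCp.

(** * The symmetric step functions *)

Section SymStep.
Context {R : realType}.

(* The sign factor makes the whole family indexed by [x] injective, so that it
   has exactly the cardinality of its index set; without it [x] and its mirror
   image [2 * z - x] would give the same function. *)
Definition sym_step (z x y : R) : R :=
  if z - `|x - z| <= y < z + `|x - z| then Num.sg (x - z) else 0.

Lemma continuous_sym_step {A : set R} (z x : R) : ~ A x -> ~ A (2 * z - x) ->
  continuous (sym_step z x : hattori A -> R).
Proof.
move=> Ax Azx; apply: continuous_hattori_itv; case: (ger0P (x - z)) => _.
- by rewrite (_ : _ - _ = 2 * z - x)//; lra.
- by rewrite (_ : _ - _ = x)//; lra.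
- by rewrite (_ : _ + _ = x)//; lra.
- by rewrite (_ : _ + _ = 2 * z - x)//; lra.
Qed.

Lemma sym_step_in (z x w : R) : `|w| < `|x - z| ->
  sym_step z x (z + w) = Num.sg (x - z).
Proof.
rewrite ltr_norml /sym_step => /andP[? ?].
by rewrite ifT//; apply/andP; split; lra.
Qed.

Lemma sym_step_out (z x w : R) : `|x - z| < `|w| -> sym_step z x (z + w) = 0.
Proof.
rewrite lter_normr /sym_step => ?; rewrite ifF//; lra.
Qed.

Lemma sym_step_center (z x : R) : sym_step z x z = Num.sg (x - z).
Proof.
(* For [x = z] the interval is empty, but the sign is 0 as well. *)
have [->|xz] := eqVneq x z; first by rewrite /sym_step subrr sgr0; case: ifP.
by rewrite -[z in sym_step _ _ z]addr0 sym_step_in// normr0 normr_gt0 subr_eq0.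
Qed.

Lemma sym_step_eq0 (z x : R) : sym_step z x z = 0 -> x = z.
Proof.
by rewrite sym_step_center => /eqP; rewrite sgr_eq0 subr_eq0 => /eqP.
Qed.

Lemma sym_step_right (z x : R) : sym_step z x (z + `|x - z|) = 0.
Proof. by rewrite /sym_step ltxx andbF. Qed.

Lemma sym_step_left (z x : R) : sym_step z x (z - `|x - z|) = Num.sg (x - z).
Proof.
have [->|xz] := eqVneq x z; first by rewrite /sym_step subrr sgr0; case: ifP.
have : 0 < `|x - z| by rewrite normr_gt0 subr_eq0.
by rewrite /sym_step lexx/= => ?; rewrite ifT//; lra.
Qed.

(** The value at [z] gives the sign of [x - z]; the distance [|x - z|] is recovered because the
    interval contains its left end but not its right end. *)
Lemma sym_step_inj (z : R) : injective (sym_step z).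
Proof.
move=> x y xy.
have sxy : Num.sg (x - z) = Num.sg (y - z).
  by rewrite -(sym_step_center z x) xy sym_step_center.
have [yz|yz] := eqVneq y z.
  by rewrite yz; apply: sym_step_eq0; rewrite xy yz sym_step_center subrr sgr0.
have sy0 : Num.sg (y - z) != 0 by rewrite sgr_eq0 subr_eq0.
suff nxy : `|x - z| = `|y - z|.
  by apply: (addIr (- z)); rewrite -[LHS]mulr_sg_norm sxy nxy mulr_sg_norm.
have /eqP := sym_step_left z x; have /eqP := sym_step_right z x.
rewrite xy sxy /sym_step.
case: ifPn => [_|+ _]; first by rewrite (negbTE sy0).
case: ifPn => [|_]; last by rewrite eq_sym (negbTE sy0).
lra.
Qed.

End SymStep.

(** * Closedness of families of steps *)

(** The finitely many values in [V] other than [Cp_eval g x] stay away from it, so no [h] close to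
    [g] takes them at [x]. *)
Lemma Cp_near_eq_cst {R : realType} {X : topologicalType} (g : Cp R X)
    (s : seq X) (V : seq R) :
  nbhs g [set h | {in s & V, forall x v, Cp_eval h x = v -> Cp_eval g x = v}].
Proof.
have H x v : nbhs g [set h | Cp_eval h x = v -> Cp_eval g x = v].
  have [->|gv] := eqVneq (Cp_eval g x) v; first exact: filterE.
  have gx : nbhs g [set h | Cp_eval h x != v].
    have gv' : nbhs (Cp_eval g x) [set y | y != v] by exact: open_nbhs_nbhs.
    exact: (Cp_eval_continuous x g _ gv').
  by apply: filterS gx => h /= /eqP.
have HV x : nbhs g
    [set h | {in V, forall v, Cp_eval h x = v -> Cp_eval g x = v}].
  elim: V => [|v V IH]; first exact: filterE.
  apply: filterS (filterI (H x v) IH) => h [/= hv hV] u.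
  by rewrite inE => /predU1P[->//|]; exact: hV.
have Hs : nbhs g
    [set h | forall x, x \in s ->
       Cp_eval h x \in V -> Cp_eval g x = Cp_eval h x].
  elim: s => [|x s IH]; first exact: filterE.
  apply: filterS (filterI IH (HV x)) => h [/= hs hV] y.
  by rewrite inE => /predU1P[->|/hs//] hxV; exact: (hV _ hxV erefl).
apply: filterS Hs => h hs x v xs vV hxv.
by rewrite hs// hxv.
Qed.

(** A common finite set of values turns approximation on [s] into equality on [s]. *)
Lemma closure_Cp_agree {R : realType} {X : topologicalType}
    (D : set (Cp R X)) (V : seq R) (g : Cp R X) (s : seq X) :
  (forall f, D f -> forall x, Cp_eval f x \in V) -> closure D g ->
  exists2 f, D f & {in s, Cp_eval f =1 Cp_eval g}.
Proof.
move=> DV /(_ _ (Cp_near_eq_cst g s V))[f [Df fs]].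
by exists f => // x xs; rewrite [RHS](fs _ _ xs (DV f Df x)).
Qed.

Lemma closed_sym_steps {R : realType} {A : set R} (z a : R)
    (D : set (Cp R (hattori A))) :
  (forall f, D f -> exists2 x, `|x - z| < a & Cp_eval f = sym_step z x) ->
  closed D.
Proof.
move=> Dstep g gD.
have approx (s : seq R) : exists f, D f /\ exists x, [/\ `|x - z| < a,
    Cp_eval f = sym_step z x & {in s, forall y, Cp_eval g y = sym_step z x y}].
  have DV f : D f -> forall y, Cp_eval f y \in [:: 0; 1; -1].
    move=> /Dstep[x _ ->] y; rewrite /sym_step.
    case: ifP; last by rewrite mem_head.
    by case: sgrP; rewrite !inE eqxx ?orbT.
  have [f Df fg] := closure_Cp_agree D _ g (s : seq (hattori A)) DV gD.
  have [x xa fx] := Dstep _ Df.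
  by exists f; split=> //; exists x; split=> // y /fg; rewrite fx.
pose c := Cp_eval g z.
(* If [c = 0], every approximating index is [z], and [g] vanishes everywhere. *)
have [c0|c0] := eqVneq c 0.
  have centered y : Cp_eval g y = sym_step z z y.
    have [f [_ [x [_ _ gx]]]] := approx [:: z; y].
    rewrite gx ?inE ?eqxx ?orbT//; congr sym_step; apply: sym_step_eq0.
    by rewrite -gx ?mem_head.
  have [f [Df [x [_ fx gx]]]] := approx [:: z].
  suff -> : g = f by [].
  apply: Cp_eval_inj; rewrite fx (_ : x = z); first exact/funext/centered.
  by apply: sym_step_eq0; rewrite -gx ?mem_head.
(* By finite approximation, [g] is [c] within distance [t := sup N] of [z] and
   [0] beyond; only the values at [z + t] and [z - t] are in question. *)
pose N := [set u | 0 <= u /\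
  (Cp_eval g (z + u) != 0 \/ Cp_eval g (z - u) != 0)].
have N0 : N 0 by split=> //; left; rewrite addr0.
(* Every list of test points starts with [z], so all approximating steps have height [c]. *)
have sgc x s : {in z :: s, forall y, Cp_eval g y = sym_step z x y} ->
    Num.sg (x - z) = c.
  by move=> gx; rewrite -sym_step_center -gx// mem_head.
have Nle u x :
    {in [:: z; z + u; z - u], forall y, Cp_eval g y = sym_step z x y} ->
    N u -> u <= `|x - z|.
  move=> gx [u0 gu]; rewrite leNgt; apply/negP => xu.
  case: gu; rewrite gx ?inE ?eqxx ?orbT//;
    by rewrite sym_step_out ?normrN ?(ger0_norm u0)// eqxx.
have Nub : ubound N a.
  move=> u Nu; have [_ [_ [x [xa _ gx]]]] := approx [:: z; z + u; z - u].
  exact: le_trans (Nle _ _ gx Nu) (ltW xa).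
have supN : has_sup N by split; [exists 0|exists a].
pose t := sup N.
have t0 : 0 <= t by exact: ub_le_sup (ex_intro _ a Nub) _ N0.
have inside w : `|w| < t -> Cp_eval g (z + w) = c.
  move=> /(sup_gt (ex_intro _ _ N0)) [u Nu wu].
  have [_ [_ [x [_ _ gx]]]] := approx [:: z; z + u; z - u; z + w].
  rewrite -(sgc _ _ gx) gx ?inE ?eqxx ?orbT// sym_step_in//.
  apply: lt_le_trans wu (Nle _ _ _ Nu) => y ys; apply: gx.
  by move: ys; rewrite !inE => /or3P[]->; rewrite ?orbT.
have outside w : t < `|w| -> Cp_eval g (z + w) = 0.
  move=> tw; apply/eqP; apply: contraLR tw => gw; rewrite -leNgt.
  apply: (ub_le_sup (ex_intro _ a Nub)); split=> //.
  by case: (ger0P w) => _; [left|right; rewrite opprK].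
(* From here on only right-continuity of [g] is used. *)
have right0 : Cp_eval g (z + t) = 0.
  apply/eqP; apply: contrapT => /negP /Cp_hattori_right[e e0 eg].
  have : z + t <= z + (t + e / 2) < z + t + e by apply/andP; split; lra.
  by move=> /eg; rewrite outside ?eqxx// ger0_norm; lra.
have {}t0 : 0 < t.
  rewrite lt_neqAle t0 andbT; apply/eqP => t_0.
  by move: right0; rewrite -t_0 addr0; exact/eqP.
have leftc : Cp_eval g (z - t) = c.
  apply/eqP; apply: contrapT => /negP /Cp_hattori_right[e e0 eg].
  (* The test point [z + (d - t)] must be within [e] to the right of [z - t] and closer to [z] than
     [t]. *)
  pose d := Num.min (e / 2) t.
  have [d0 de dt] : [/\ 0 < d, d < e & d <= t].
    rewrite /d lt_min ge_min gt_min lexx orbT t0 andbT; split=> //; first by lra.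
    by apply/orP; left; lra.
  have : z - t <= z + (d - t) < z - t + e by apply/andP; split; lra.
  move=> /eg; rewrite inside ?eqxx// ltr_norml; apply/andP; split; lra.
have [f [Df [x [xa fx gx]]]] := approx [:: z; z + t; z - t].
(* The values [0] at [z + t] and [c] at [z - t] pin down the index [x]. *)
have xt : `|x - z| = t.
  apply/eqP; rewrite eq_le; apply/andP; split; rewrite leNgt; apply/negP => xt.
    move: right0; rewrite gx ?inE ?eqxx ?orbT//.
    by rewrite sym_step_in ?(sgc _ _ gx) ?(gtr0_norm t0)//; exact/eqP.
  move: leftc; rewrite gx ?inE ?eqxx ?orbT//.
  by rewrite sym_step_out ?normrN ?(gtr0_norm t0)// => /esym; exact/eqP.
suff -> : g = f by [].
apply: Cp_eval_inj; rewrite fx; apply/funext => y.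
rewrite -(subrKC z y).
have [yt|ty|yt] := ltgtP `|y - z| t.
- by rewrite inside// sym_step_in ?xt// (sgc _ _ gx).
- by rewrite outside// sym_step_out ?xt.
- apply: gx; move: yt; case: (ger0P (y - z)) => _ <-.
    by rewrite !inE eqxx orbT.
  by rewrite opprK !inE eqxx !orbT.
Qed.

(** * Failure of normality *)

Lemma countable_dense_subset {R : realType} (E : set R) :
  exists Q : set R, [/\ Q `<=` E, countable Q &
    forall x, E x -> forall e : R, 0 < e -> exists2 q, Q q & `|q - x| < e].
Proof.
pose K (k : rat * rat) : set R := E `&` `]ratr k.1, ratr k.2[.
(* One point of [E] from each rational interval meeting it; the default 0 of [xget] never
   intervenes. *)
exists [set xget 0 (K k) | k in [set k | K k !=set0]]; split.
- by move=> _ [k [y Ky] <-]; have [] := xgetPex 0 (ex_intro _ y Ky).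
- exact: sub_countable (card_image_le _ _) (countableP _).
move=> x Ex e e0.
have [r xr] : exists r : rat, ratr r \in `]x - e, x[.
  by apply: rat_in_itvoo; lra.
have [t xt] : exists t : rat, ratr t \in `]x, x + e[.
  by apply: rat_in_itvoo; lra.
move: xr xt; rewrite !in_itv/= => /andP[? ?] /andP[? ?].
have Kx : K (r, t) x by split=> //=; rewrite in_itv/=; apply/andP.
exists (xget 0 (K (r, t))); first by exists (r, t) => //; exists x.
have [_] := xgetPex 0 (ex_intro _ x Kx); rewrite /= in_itv/= => /andP[? ?].
by rewrite ltr_norml; apply/andP; split; lra.
Qed.

Lemma sym_step_locally_cst {R : realType} (z x y : R) :
  x != z -> y != x -> y != 2 * z - x ->
  exists2 e : R, 0 < e & forall q,
    `|q - x| < e -> sym_step z q y = sym_step z x y.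
Proof.
move=> xz yx yzx.
(* The first bound keeps [q] on the same side of [z] as [x]; the second prevents [|q - z|] from
   crossing [|y - z|]. *)
exists (Num.min `|x - z| `| `|x - z| - `|y - z| |).
  rewrite lt_min !normr_gt0 !subr_eq0 xz/= eqr_norm2.
  rewrite negb_or; apply/andP.
  by split; apply/eqP => ?; [move/eqP: yx|move/eqP: yzx]; lra.
move=> q; rewrite lt_min => /andP[qx qy].
have sq : Num.sg (q - z) = Num.sg (x - z).
  move: qx; rewrite ltr_norml; case: (sgrP (x - z)) => xz' /andP[? ?].
  - by move: xz; rewrite -subr_eq0 xz' eqxx.
  - by rewrite gtr0_sg//; lra.
  - by rewrite ltr0_sg//; lra.
have qn : `| `|q - z| - `|x - z| | <= `|q - x|.
  by rewrite (_ : q - x = (q - z) - (x - z)) ?ler_dist_dist//; lra.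
rewrite -(subrKC z y).
have [yx'|xy'] := ltP `|y - z| `|x - z|.
  rewrite (sym_step_in z x)// (sym_step_in z q)//.
  move: qn qy; rewrite ler_norml (@gtr0_norm _ (_ - `|y - z|)) ?subr_gt0//; lra.
have {}xy' : `|x - z| < `|y - z|.
  rewrite lt_neqAle xy' andbT; apply/eqP => h.
  by move: qy; rewrite h subrr normr0 ltNge normr_ge0.
rewrite (sym_step_out z x)// (sym_step_out z q)//.
move: qn qy; rewrite ler_norml (@ltr0_norm _ (_ - `|y - z|)) ?subr_lt0//; lra.
Qed.


Lemma sym_step_locally_cst_seq {R : realType} (z x : R) (s : seq R) : x != z ->
  exists2 e : R, 0 < e & forall q, `|q - x| < e -> forall y, y \in s ->
    y != x -> y != 2 * z - x -> sym_step z q y = sym_step z x y.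
Proof.
move=> xz; elim: s => [|y s [e e0 es]]; first by exists 1.
have [yx|/negPn yx] := boolP ((y != x) && (y != 2 * z - x)); last first.
  exists e => // q /es qs w; rewrite inE => /predU1P[->|]; last exact: qs.
  by move=> wx wzx; rewrite wx wzx in yx.
have /andP[yx1 yx2] := yx.
have [d d0 ds] := sym_step_locally_cst _ _ _ xz yx1 yx2.
exists (Num.min d e); first by rewrite lt_min d0.
move=> q; rewrite lt_min => /andP[/ds qd /es qe] w.
by rewrite inE => /predU1P[->|/qe].
Qed.

Lemma not_normal_sym_steps {R : realType} {A : set R} (z : R) (E : set R)
    (phi : R -> Cp R (hattori A)) :
  (forall x, E x -> Cp_eval (phi x) = sym_step z x) ->
  (forall D, D `<=` phi @` E -> closed D) ->
  ~ countable E -> ~ normal_space (Cp R (hattori A)).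
Proof.
move=> phiE closedE Ec /(normal_openP (R := R)) normal; apply: Ec.
have [Q [QE Qc Qdense]] := countable_dense_subset E.
have [||| U [V [oU oV EU QV UV0]]] := normal (phi @` (E `\` Q)) (phi @` Q).
- by apply: closedE; apply: image_subset => x [].
- by apply: closedE; exact: image_subset.
- apply/seteqP; split=> // _ [[x [Ex Qx] <-] [q Qq qx]]; apply: Qx.
  rewrite -(_ : q = x)//; apply: (sym_step_inj z).
  by rewrite -!phiE ?qx//; exact: QE.
have /choice[F FV] q : exists s : seq R, Q q ->
    forall g, {in s, Cp_eval g =1 Cp_eval (phi q)} -> V g.
  have [Qq|//] := pselect (Q q); last by exists [::].
  have [s sV] := Cp_nbhs_agree (phi q) V
    (open_nbhs_nbhs (conj oV (QV _ (imageP _ Qq)))).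
  by exists s.
(* Avoiding every [S q] gives [x] outside [Q], different from [z], and with neither [x] nor its
   mirror image in [F q]. *)
pose S q := [:: q, z & F q ++ [seq 2 * z - y | y <- F q]].
suff ES : E `<=` \bigcup_(q in Q) [set` S q].
  apply: sub_countable (subset_card_le ES) _.
  by apply: bigcup_countable => // q _; exact/finite_set_countable/finite_seq.
move=> x Ex; apply: contrapT => xS.
have {}xS q : Q q -> x \notin S q.
  by move=> Qq; apply/negP => xSq; apply: xS; exists q.
have Qx : ~ Q x by move=> /xS; rewrite mem_head.
have xz : x != z.
  (* Density with radius 1 merely supplies some [q] in [Q]. *)
  have [q /xS + _] := Qdense x Ex 1 ltr01.
  by rewrite !inE !negb_or => /and3P[].
have [G GU] := Cp_nbhs_agree (phi x) U
  (open_nbhs_nbhs (conj oU (EU _ (imageP phi (conj Ex Qx))))).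
have [e e0 eG] := sym_step_locally_cst_seq z x G xz.
have [q Qq qx] := Qdense x Ex e e0.
(* On [G] the two branches agree wherever [y] is in [F q], since such a [y] is neither [x] nor
   [2 * z - x]. *)
pose v y := if y \in F q then sym_step z q y else sym_step z x y.
have mirror (w : R) : w = 2 * z - x -> x = 2 * z - w by move=> ->; lra.
have [h hv] := @Cp_hattori_interp R A (F q ++ G) v.
suff : (U `&` V) h by rewrite UV0.
split.
  apply: GU => y yG; rewrite phiE// [LHS]hv ?mem_cat ?yG ?orbT// /v.
  case: ifPn => // yF; apply: (eG _ qx) => //; apply: contraNneq (xS q Qq) => yx.
    by rewrite !inE mem_cat -yx yF !orbT.
  have xF : x \in [seq 2 * z - y | y <- F q].
    by apply/mapP; exists y; last exact: mirror.
  by rewrite !inE mem_cat xF !orbT.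
apply: (FV q Qq) => y yF.
rewrite phiE; last exact: QE.
by rewrite [LHS]hv ?mem_cat ?yF// /v ifT.
Qed.

(** * Discreteness and conclusion *)

Lemma discrete_subspace_closed_subsets {T : topologicalType} (D : set T) :
  (forall D', D' `<=` D -> closed D') -> discrete_subspace D.
Proof.
move=> closedD U; exists (~` (set_val @` (~` U))).
  by apply: closed_openC; apply: closedD => _ [u _ <-]; exact: set_valP.
apply/seteqP; split=> u /=.
  by move=> uU; apply: contrapT => Uu; apply: uU; exists u.
by move=> Uu [w Uw wu]; apply: Uw; rewrite (_ : w = u)//; exact: val_inj.
Qed.

Theorem theorem9 (R : realType) (A : set R) (z a : R) :
  let B := ~` A in
  let I : set R := `]z - a, z + a[%classic in
  0 < a ->
  I `<=` closure (B `&` I) ->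
  symmetric_wrt z (B `&` I) ->
  ~ countable (B `&` I) ->
  (exists D : set (Cp R (hattori A)),
      [/\ closed D, discrete_subspace D & D #= B `&` I]) /\
  ~ normal_space (Cp R (hattori A)).
Proof.
move=> B I _ _ symE Ec; set E := B `&` I.
have /choice[phi phiE] x : exists f : Cp R (hattori A),
    E x -> Cp_eval f = sym_step z x.
  (* Choice needs a function for every real [x]; outside [E] an empty interpolation problem supplies
     one. *)
  have [Ex|nEx] := pselect (E x); last first.
    have [f _] := @Cp_hattori_interp R A [::] (fun=> 0).
    by exists f.
  have [Ax _] := Ex; have [Azx _] := symE _ Ex.
  by have [f fx] := Cp_evalP _ (continuous_sym_step z x Ax Azx); exists f.
have closedE D : D `<=` phi @` E -> closed D.
  move=> DE; apply: (closed_sym_steps z a) => _ /DE[x Ex <-].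
  exists x; last exact: phiE.
  by have [_] := Ex; rewrite /I/= in_itv/= ltr_distl.
split; last exact: not_normal_sym_steps phiE closedE Ec.
exists (phi @` E); split; first exact: closedE.
- exact: discrete_subspace_closed_subsets.
- apply: inj_card_eq => x y /set_mem Ex /set_mem Ey xy.
  by apply: (sym_step_inj z); rewrite -!phiE// xy.
Qed.
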